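(* Let $z_{i,j}\in\mathbb{C}(x_a^b)$ ($1\le i\le m$, $i\le j\le n$) be the rational functions giving the entries of the geometric RSK $P$-pattern of the $m\times n$ matrix $\mathbf{x}=(x_a^b)$. Then the field ${\rm Inv}_e$ of invariants of the geometric crystal operators $e_1,\dots,e_{m-1}$ equals $\mathbb{C}(z_{i,j})$.
   Context: $\mathbb{C}(x_a^b)$ is the field of rational functions in indeterminates $x_a^b$, $a\in[m]$, $b\in[n]$; $\mathbf{x}_a=(x_a^1,\dots,x_a^n)$ is the $a$th row. For $u,v\in(\mathbb{C}^* )^n$, $\sigma^j(u,v;c)=\sum_{r=1}^n c^{\mathbb{1}_{r\le j}}v^1\cdots v^{r-1}u^{r+1}\cdots u^n$. The operator $e_i^c$ ($i\in[m-1]$, $c\in\mathbb{C}^*$) fixes rows other than $i,i+1$ and replaces $x_i^j$ by $x_i^j\sigma^j/\sigma^{j-1}$ and $x_{i+1}^j$ by $x_{i+1}^j\sigma^{j-1}/\sigma^j$, where $\sigma^k=\sigma^k(\mathbf{x}_i,\mathbf{x}_{i+1};c)$. ${\rm Inv}_e=\{f\in\mathbb{C}(x_a^b): f\circ e_i^c=f\text{ for all }i\in[m-1]\}$ (identity of rational functions in $\mathbf{x}$ and $c$). Let $W(y_1,\dots,y_n)$ be the $n\times n$ matrix with diagonal $y_1,\dots,y_n$, $1$'s directly below the diagonal and $0$ elsewhere, $M=W(\mathbf{x}_1)\cdots W(\mathbf{x}_m)$, and for $I\subseteq[n]$ let $\Delta_I(M)$ be the minor with rows $I$ and columns $[1,|I|]$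 ($\Delta_\emptyset=1$). The $P$-pattern entries are $z_{i,j}=\Delta_{[i,j]}(M)/\Delta_{[i+1,j]}(M)$. *)

(* Defs.v *)
From HB Require Import structures.
From mathcomp Require Import all_boot all_order all_algebra.
From mathcomp Require Import generic_quotient fraction.
From mathcomp Require Import mpoly.
From mathcomp Require Import complex.
From mathcomp Require Import reals.

Set Implicit Arguments.
Unset Strict Implicit.
Unset Printing Implicit Defensive.

Import Order.TTheory GRing.Theory Num.Theory.
Local Open Scope ring_scope.

Section GeomRSK.

(* The complex numbers: C = R[i] for R the (unique up to iso) real field. *)
Variable R : realType.
Local Notation C := (complex R).

Variables m n : nat.

(* C(x_a^b): rational functions in the m*n indeterminates x_a^b; the
   indeterminate x_a^b (0-based a < m, b < n) is variable mxvec_index a b. *)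
Definition Kx := {fraction {mpoly C[m * n]}}.
Definition Kxc := {fraction {mpoly C[(m * n).+1]}}.

Definition xvar (a : 'I_m) (b : 'I_n) : Kx :=
  tofrac ('X_(mxvec_index a b) : {mpoly C[m * n]}).

Definition yvar (a : 'I_m) (b : 'I_n) : Kxc :=
  tofrac ('X_(widen_ord (leqnSn _) (mxvec_index a b)) : {mpoly C[(m * n).+1]}).

Definition cvar : Kxc := tofrac ('X_ord_max : {mpoly C[(m * n).+1]}).

Definition yrow (a : nat) (b : 'I_n) : Kxc :=
  if insub a is Some a' then yvar a' b else 0.

(* sigma^j(u, v; c) = sum_{r=1}^n c^{1_{r <= j}} v^1..v^{r-1} u^{r+1}..u^n
   (written 0-based in r and in the coordinates of u, v). *)
Definition sigma (u v : 'I_n -> Kxc) (c : Kxc) (j : nat) : Kxc :=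
  \sum_(r < n) (if (r < j)%N then c else 1)
               * (\prod_(t < n | (t < r)%N) v t) * (\prod_(t < n | (r < t)%N) u t).

(* The images of the indeterminates under e_i^c (0-based row index i,
   i.e. the paper's e_{i+1}^c, acting on rows i and i+1). *)
Definition e_img (i : nat) : 'M[Kxc]_(m, n) :=
  let s := sigma (yrow i) (yrow i.+1) cvar in
  \matrix_(a < m, b < n)
    if (a : nat) == i then yvar a b * s b.+1 / s b
    else if (a : nat) == i.+1 then yvar a b * s b / s b.+1
    else yvar a b.

Definition id_img : 'M[Kxc]_(m, n) := \matrix_(a < m, b < n) yvar a b.

Definition psubst (g : 'M[Kxc]_(m, n)) (p : {mpoly C[m * n]}) : Kxc :=
  mmap (fun c : C => tofrac (c%:MP : {mpoly C[(m * n).+1]}))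
       (fun k => mxvec g 0 k) p.

Definition rcomp (g : 'M[Kxc]_(m, n)) (f : Kx) : Kxc :=
  psubst g (frac (repr f)).1 / psubst g (frac (repr f)).2.

Definition Inv_e (f : Kx) : Prop :=
  forall i : nat, (i.+1 < m)%N -> rcomp (e_img i) f = rcomp id_img f.

Definition Wmx (y : 'I_n -> Kx) : 'M[Kx]_n :=
  \matrix_(r < n, s < n)
    if r == s then y s else if (r : nat) == s.+1 then 1 else 0.

Definition Mmx : 'M[Kx]_n :=
  foldr (fun a A => Wmx (xvar a) *m A) 1%:M (enum 'I_m).

Definition entry (A : 'M[Kx]_n) (r s : nat) : Kx :=
  match insub r, insub s with Some r', Some s' => A r' s' | _, _ => 0 end.

(* Delta_{[i, j]}(A) for 1-based 1 <= i, j <= n: the minor with rows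
   i..j and columns 1..(j-i+1); equals 1 when the interval is empty. *)
Definition Delta (A : 'M[Kx]_n) (i j : nat) : Kx :=
  \det (\matrix_(r < j.+1 - i, s < j.+1 - i) entry A (i.-1 + r) s).

Definition z (i j : nat) : Kx := Delta Mmx i j / Delta Mmx i.+1 j.

Definition gen_subfield (gens : Kx -> Prop) (f : Kx) : Prop :=
  forall S : Kx -> Prop,
    (forall c : C, S (tofrac (c%:MP : {mpoly C[m * n]}))) ->
    (forall g, gens g -> S g) ->
    (forall a b, S a -> S b -> S (a - b)) ->
    (forall a b, S a -> S b -> S (a * b)) ->
    (forall a, S a -> S a^-1) ->
    S f.

Definition z_gens (g : Kx) : Prop :=
  exists i j : nat, [/\ 1 <= i <= m, i <= j <= n & g = z i j]%N.

End GeomRSK.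

(* Main.v *)
(* The operator e_i^c preserves W(x_i) W(x_(i+1)), hence the matrix M and all the
   z_(i,j). Conversely, let f be invariant. Over K = C(x), an orbit of the operators
   starting from the generic point x contains a point Y whose entries Y_a^b with
   a + b <= m are elements of C, chosen outside finite exceptional sets: the operators
   e_i, ..., e_(i+k-1), applied in decreasing order, can prescribe the first k entries
   of row i. Since M(Y) = M(x), the other entries of Y are rational functions of the
   entries of M, by the band structure of W(x_a) ... W(x_m). The entries of M are in
   turn rational functions of the minors Delta_[i,j], none of which vanishes, and so
   f(x) = f(Y) lies in C(z_(i,j)). *)
Require Import Defs.
From HB Require Import structures.
From mathcomp Require Import all_boot all_order all_algebra.
From mathcomp Require Import generic_quotient fraction mpoly complex reals.
From mathcomp Require Import ring.

Set Implicit Arguments.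
Unset Strict Implicit.
Unset Printing Implicit Defensive.

Import Order.TTheory GRing.Theory Num.Theory.
Local Open Scope ring_scope.

(** The obstacle is that the operators are only partially defined, while invariance is an identity
    in C(x, c): it says something about a K-point X and a value of c only when the sigma^j and the
    denominator of f do not vanish there. Each step of the orbit must therefore join two points
    where the function [good] is nonzero. To control this, the operator is reparametrised: instead
    of c, the datum is the new first entry a of row i, which forces the other new entries as
    rational functions of a. The value a = [X i 0] gives back X, so a condition that is regular and
    nonzero at X stays so for all but finitely many a. Each choice thus excludes finitely many
    values only, and the subfield is infinite. *)

Local Notation "p %:F" := (tofrac p).

(** * Crystal operators *)

Section Moves.

Variables (K : fieldType) (n : nat).
Implicit Types (u v : nat -> K) (a c : K).

Definition sigterm u v r : K :=
  (\prod_(0 <= t < r) v t) * (\prod_(r.+1 <= t < n) u t).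

(* [sig u v c j] is the paper's sigma^j(u, v; c), for [j <= n]. *)
Definition sig u v c j : K :=
  \sum_(0 <= r < n) sigterm u v r + (c - 1) * \sum_(0 <= r < j) sigterm u v r.

Lemma sig0 u v c : sig u v c 0 = \sum_(0 <= r < n) sigterm u v r.
Proof. by rewrite /sig [X in _ * X]big_geq // mulr0 addr0. Qed.

Lemma sigS u v c j : sig u v c j.+1 = sig u v c j + (c - 1) * sigterm u v j.
Proof. by rewrite /sig big_nat_recr //= mulrDr addrA. Qed.

(** Both sides are v_0 ... v_r u_(r+1) ... u_(n-1). *)
Lemma sigtermS u v r : (r.+1 < n)%N ->
  u r.+1 * sigterm u v r.+1 = v r * sigterm u v r.
Proof.
move=> ltrn; rewrite /sigterm big_nat_recr //=.
by rewrite [\prod_(r.+1 <= _ < n) _]big_ltn //; ring.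
Qed.

(** The product of the bidiagonal matrices of [u] and [v] has diagonal u_b v_b, then v_b + u_(b+1)
    just below it, then 1's. The former are preserved here, the latter in [sig_swapD]. *)
Lemma sig_swapM u v c b : sig u v c b != 0 -> sig u v c b.+1 != 0 ->
  u b * sig u v c b.+1 / sig u v c b * (v b * sig u v c b / sig u v c b.+1) = u b * v b.
Proof. by move=> nz nz1; field; rewrite nz nz1. Qed.

Lemma sig_swapD u v c b : (b.+1 < n)%N -> sig u v c b.+1 != 0 ->
  v b * sig u v c b / sig u v c b.+1 + u b.+1 * sig u v c b.+2 / sig u v c b.+1 =
  v b + u b.+1.
Proof.
move=> ltb nz; rewrite -mulrDl; apply: (mulIf nz); rewrite divfK //.
have -> : u b.+1 * sig u v c b.+2 =
    u b.+1 * sig u v c b.+1 + (c - 1) * (v b * sigterm u v b).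
  by rewrite -sigtermS // [sig u v c b.+2]sigS; ring.
rewrite sigS; ring.
Qed.

(** The new first row, as forced by its first entry [a] when all u_b v_b and v_b + u_(b+1) are kept:
    the new v_b is u_b v_b divided by the new u_b. *)
Fixpoint etil u v a b : K :=
  if b is b'.+1 then v b' + u b - u b' * v b' / etil u v a b' else a.

Lemma etil_id u v b : (forall j, (j < b)%N -> u j != 0) ->
  etil u v (u 0%N) b = u b.
Proof.
elim: b => [|b IHb] //= nzu; rewrite IHb => [|j ltjb]; last exact/nzu/ltnW.
by rewrite [u b * _]mulrC mulfK ?nzu // addrAC subrr add0r.
Qed.

Lemma eq_etil u v u' v' a b :
    (forall j, (j <= b)%N -> u j = u' j) -> (forall j, (j < b)%N -> v j = v' j) ->
  etil u v a b = etil u' v' a b.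
Proof.
elim: b => [|b IHb] //= equ eqv; rewrite IHb => [|j lejb|j ltjb].
- by rewrite !equ ?eqv.
- exact/equ/leqW.
exact/eqv/ltnW.
Qed.

(* The move of rows [i, i+1] prescribing the entry [(i, 0)] is the crystal
   operator for the parameter [c] solving [u^1 sigma^1 = a sigma^0]. *)
Lemma etil_sig u v a c :
    (forall b, (b < n)%N -> u b != 0) -> (forall b, (b < n)%N -> etil u v a b != 0) ->
    sig u v c 0 != 0 -> u 0%N * sig u v c 1 = a * sig u v c 0 ->
  forall b, (b < n)%N -> sig u v c b != 0 /\ u b * sig u v c b.+1 = etil u v a b * sig u v c b.
Proof.
move=> nzu nze nzs0 eq0; elim=> [|b IHb] ltbn //.
have ltb : (b < n)%N by exact: ltnW.
have [nzs Es] := IHb ltb; split.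
  apply: contraNneq (mulf_neq0 (nze _ ltb) nzs) => s0.
  by rewrite -Es s0 mulr0.
have sE : sig u v c b = u b * sig u v c b.+1 / etil u v a b.
  by rewrite Es mulrAC mulfV ?mul1r ?nze.
have Ev : v b * sig u v c b = v b * sig u v c b.+1 - (c - 1) * (u b.+1 * sigterm u v b.+1).
  rewrite sigtermS // sigS; ring.
transitivity (v b * sig u v c b.+1 + u b.+1 * sig u v c b.+1 - v b * sig u v c b).
  by rewrite Ev sigS; ring.
rewrite [X in _ - _ * X = _]sE /=; ring.
Qed.

Lemma etil_sigV u v a c b : u b * sig u v c b.+1 = etil u v a b * sig u v c b ->
    etil u v a b != 0 -> sig u v c b.+1 != 0 ->
  u b * v b / etil u v a b = v b * sig u v c b / sig u v c b.+1.
Proof.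
move=> eqs nze nzs; apply/eqP; rewrite eqr_div //.
by rewrite mulrAC eqs; apply/eqP; ring.
Qed.

Lemma exists_sig_param u v a : (0 < n)%N -> (forall b, (b < n)%N -> u b != 0) ->
  exists c, u 0%N * sig u v c 1 = a * sig u v c 0.
Proof.
move=> n_gt0 nzu; have nz0 : sigterm u v 0 != 0.
  rewrite /sigterm big_geq // mul1r prodf_seq_neq0; apply/allP => t.
  by rewrite mem_index_iota => /andP[_ /nzu].
(* The equation is affine in [c], as sigma^1 = sigma^0 + (c - 1) [sigterm u v 0]. The parameter in
   [sig u v 0 0] is arbitrary, sigma^0 being independent of it. *)
exists (1 + (a / u 0%N - 1) * sig u v 0 0 / sigterm u v 0).
rewrite sigS !sig0 [1 + _ - 1]addrAC subrr add0r divfK // mulrDl mulN1r.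
by rewrite addrC subrK mulrA [u _ * _]mulrC divfK ?nzu.
Qed.

End Moves.

(** * Products of bidiagonal matrices *)

Section BandProducts.

Variables (R : comNzRingType).
Implicit Types (y u v : nat -> R) (l : seq (nat -> R)) (r s d : nat).

(* Entries of the product of the bidiagonal matrices of the rows [l], indexed by
   all of [nat]: row [r] of the product only involves the rows [<= r]. *)
Fixpoint bprod l r s : R :=
  if l is y :: l' then
    y r * bprod l' r s + (if r is r'.+1 then bprod l' r' s else 0)
  else (r == s)%:R.

Lemma eq_bprod_cons y y' l l' n :
    (forall r, (r < n)%N -> y r = y' r) ->
    (forall r s, (r < n)%N -> bprod l r s = bprod l' r s) ->
  forall r s, (r < n)%N -> bprod (y :: l) r s = bprod (y' :: l') r s.
Proof. by move=> eqy eql [|r] s ltrn /=; rewrite ?eql ?eqy // ltnW. Qed.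

(** Row r of the product is u_r v_r L_r + (v_(r-1) + u_r) L_(r-1) + L_(r-2), where L_j is row j of
    the product of [l]; only these two combinations of [u] and [v] enter. *)
Lemma eq_bprod_swap (u v u' v' : nat -> R) l n :
    (forall b, (b < n)%N -> u b * v b = u' b * v' b) ->
    (forall b, (b.+1 < n)%N -> v b + u b.+1 = v' b + u' b.+1) ->
  forall r s, (r < n)%N -> bprod [:: u, v & l] r s = bprod [:: u', v' & l] r s.
Proof.
move=> eqd eqs [|r] s ltrn /=; first by rewrite !mulrDr !mulrA eqd // !mulr0.
rewrite !mulrDr !mulrA eqd // -!addrA; congr (_ + _).
by rewrite !addrA -!mulrDl addrC [u' _ + _]addrC [u _ + _]addrC eqs // addrC.
Qed.

Lemma eq_bprod_map n (X Y : nat -> nat -> R) t :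
    (forall a r, a \in t -> (r < n)%N -> X a r = Y a r) ->
  forall r s, (r < n)%N -> bprod (map X t) r s = bprod (map Y t) r s.
Proof.
elim: t => [|a t IHt] //= eqXY; apply: eq_bprod_cons => [r|].
  by apply: eqXY; rewrite mem_head.
by apply: IHt => a' r ta'; apply: eqXY; rewrite inE ta' orbT.
Qed.

Lemma eq_bprod_iota n i j k (X Y : nat -> nat -> R) :
    (j <= i)%N -> (i.+1 < j + k)%N ->
    (forall a b, a != i -> a != i.+1 -> (b < n)%N -> X a b = Y a b) ->
    (forall b, (b < n)%N -> X i b * X i.+1 b = Y i b * Y i.+1 b) ->
    (forall b, (b.+1 < n)%N -> X i.+1 b + X i b.+1 = Y i.+1 b + Y i b.+1) ->
  forall r s, (r < n)%N -> bprod (map X (iota j k)) r s = bprod (map Y (iota j k)) r s.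
Proof.
move=> leji ltijk eqXY eqM eqD; elim: k j leji ltijk => [|k IHk] j leji.
  by rewrite addn0 => ltij; move: (leq_trans ltij leji); rewrite ltnNge leqnSn.
have [->|nji] := eqVneq j i; last first.
  move=> ltijk; apply: eq_bprod_cons => [r ltrn|].
    by apply: eqXY => //; rewrite neq_ltn ltnS leji.
  by apply: IHk; [rewrite ltn_neqAle nji | rewrite addSnnS].
case: k IHk => [|k] _; first by rewrite addn1 ltnn.
rewrite -[iota i k.+2]/[:: i, i.+1 & iota i.+2 k] !map_cons => _ r s ltrn.
transitivity (bprod [:: X i, X i.+1 & map Y (iota i.+2 k)] r s).
  move: r s ltrn; apply: eq_bprod_cons => //; apply: eq_bprod_cons => //.
  apply: eq_bprod_map => a b.
  rewrite mem_iota => /andP[lta _] ltbn.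
  by apply: eqXY => //; rewrite neq_ltn ?lta ?(ltnW lta) orbT.
by apply: (@eq_bprod_swap _ _ _ _ _ n).
Qed.

Lemma bprod_upper l r s : (r < s)%N -> bprod l r s = 0.
Proof.
elim: l r => [|y l IHl] [|r] ltrs //=.
- by rewrite ltn_eqF.
- by rewrite ltn_eqF.
- by rewrite IHl // mulr0 addr0.
by rewrite !IHl ?mulr0 ?addr0 // (ltnW ltrs).
Qed.

Lemma bprod_below l r s : (s + size l < r)%N -> bprod l r s = 0.
Proof.
elim: l r => [|y l IHl] [|r] //=; first by rewrite addn0 => /gtn_eqF ->.
rewrite addnS ltnS => ltsr.
by rewrite !IHl ?mulr0 ?addr0 // ltnS (ltnW ltsr).
Qed.

(** The outermost band is the product of the subdiagonals of 1's of the factors. *)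
Lemma bprod_edge l s : bprod l (s + size l) s = 1.
Proof.
elim: l => [|y l IHl] /=; first by rewrite addn0 eqxx.
by rewrite addnS IHl bprod_below ?mulr0 ?add0r.
Qed.

Lemma bprod_nseq1 k s : bprod (nseq k (fun=> 1)) s s = 1.
Proof.
elim: k s => [|k IHk] s /=; first by rewrite eqxx.
by rewrite IHk mul1r; case: s => [|s]; rewrite ?bprod_upper ?addr0.
Qed.

(** Each factor with zero diagonal shifts rows down by one; the other factors give a lower
    triangular matrix with unit diagonal, which lands on r = s + d. *)
Lemma bprod_nseq01 d k r s : (r <= s + d)%N ->
  bprod (nseq d (fun=> 0) ++ nseq k (fun=> 1)) r s = (r == s + d)%N%:R.
Proof.
elim: d r => [|d IHd] r /=.
  rewrite addn0 leq_eqVlt => /orP[/eqP->|ltrs]; first by rewrite bprod_nseq1 eqxx.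
  by rewrite bprod_upper // ltn_eqF.
rewrite mul0r add0r addnS; case: r => [|r] //= lers.
exact: IHd.
Qed.

End BandProducts.

(** * Recovering the factors of a product inside a subfield *)

Section Subfield.

Variables (K : fieldType) (S : K -> Prop).
Hypothesis S1 : S 1.
Hypothesis SB : forall a b, S a -> S b -> S (a - b).
Hypothesis SM : forall a b, S a -> S b -> S (a * b).
Hypothesis SV : forall a, S a -> S a^-1.

Lemma subfield0 : S 0. Proof. by rewrite -(subrr 1); apply: SB. Qed.

Lemma subfieldN a : S a -> S (- a).
Proof. by rewrite -[- a]add0r => Sa; apply: SB => //; apply: subfield0. Qed.

Lemma subfieldD a b : S a -> S b -> S (a + b).
Proof. by move=> Sa Sb; rewrite -[b]opprK; apply: SB => //; apply: subfieldN. Qed.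

Lemma subfield_sum I (r : seq I) (P : pred I) (F : I -> K) :
  (forall i, P i -> S (F i)) -> S (\sum_(i <- r | P i) F i).
Proof. by move=> SF; apply: big_ind => //; [apply: subfield0 | apply: subfieldD]. Qed.

Lemma subfield_prod I (r : seq I) (P : pred I) (F : I -> K) :
  (forall i, P i -> S (F i)) -> S (\prod_(i <- r | P i) F i).
Proof. by move=> SF; apply: big_ind. Qed.

Lemma subfieldX a k : S a -> S (a ^+ k).
Proof. by move=> Sa; elim: k => [|k IHk]; rewrite ?expr0 // exprS; apply: SM. Qed.

Lemma subfield_det k (A : 'M[K]_k) : (forall i j, S (A i j)) -> S (\det A).
Proof.
move=> SA; apply: subfield_sum => p _; apply: SM; last exact: subfield_prod.
exact/subfieldX/subfieldN.
Qed.

(* Above the antidiagonal the rows are prescribed; each remaining entry is then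
   read off the outermost band of the remaining product, where
   [bprod l' (s + size l') s = 1]. *)
Lemma subfield_bprod n l :
    (forall a b, (a < size l)%N -> (b < n)%N -> nth (fun=> 0) l a b != 0) ->
    (forall a b, (a + b.+1 < size l)%N -> (b < n)%N -> S (nth (fun=> 0) l a b)) ->
    (forall r s, (r < n)%N -> S (bprod l r s)) ->
  forall a b, (a < size l)%N -> (b < n)%N -> S (nth (fun=> 0) l a b).
Proof.
elim: l => [|y l IHl] //= nzl Sl SM0.
(* Row b of the full product is y_b L_b + L_(b-1), with L the product of [l]. Once L_(b-1) is known,
   y_b is either prescribed or read in the column where L_b equals 1, and division by y_b then gives
   all of L_b. *)
have step b : (b < n)%N -> S (y b) /\ forall s, S (bprod l b s).
  elim: b => [|b IHb] ltbn.
    suff Sy : S (y 0%N).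
      split=> // s; have := SM0 0%N s ltbn; rewrite addr0 => Sys.
      by rewrite -[bprod _ _ _](mulKf (nzl 0%N 0%N isT ltbn)); apply: SM => //; apply: SV.
    case: (posnP (size l)) => [sz0|sz]; last exact: (Sl 0%N 0%N).
    have := SM0 0%N 0%N ltbn; rewrite addr0.
    by rewrite -[X in bprod l X _](add0n 0%N) -sz0 bprod_edge mulr1.
  have [_ SMb] := IHb (ltnW ltbn).
  suff Sy : S (y b.+1).
    split=> // s; have /SB/(_ (SMb s)) := SM0 b.+1 s ltbn; rewrite addrK => Sys.
    by rewrite -[bprod _ _ _](mulKf (nzl 0%N b.+1 isT ltbn)); apply: SM => //; apply: SV.
  have [ltbl|lelb] := ltnP b.+1 (size l); first exact: (Sl 0%N b.+1).
  have /SB/(_ (SMb (b.+1 - size l)%N)) := SM0 b.+1 (b.+1 - size l)%N ltbn.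
  have -> : bprod l b.+1 (b.+1 - size l) = 1.
    by rewrite -{1}(subnK lelb) bprod_edge.
  by rewrite addrK mulr1.
move=> [|a] b ltal ltbn; first by have [] := step b ltbn.
apply: IHl => // [a' b'|a' b' lt1|r s ltrn].
- exact: (nzl a'.+1).
- exact: (Sl a'.+1).
by have [_] := step r ltrn.
Qed.

Lemma subfield_point m n (X : nat -> nat -> K) :
    (forall a b, (a < m)%N -> (b < n)%N -> X a b != 0) ->
    (forall a b, (a + b.+1 < m)%N -> (b < n)%N -> S (X a b)) ->
    (forall r s, (r < n)%N -> S (bprod (map X (iota 0 m)) r s)) ->
  forall a b, (a < m)%N -> (b < n)%N -> S (X a b).
Proof.
move=> nzX SX Sprod.
have nthX a b : (a < m)%N -> nth (fun=> 0) (map X (iota 0 m)) a b = X a b.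
  by move=> lta; rewrite (nth_map 0%N) ?size_iota // nth_iota.
have sz : size (map X (iota 0 m)) = m by rewrite size_map size_iota.
have := subfield_bprod (l := map X (iota 0 m)) _ _ Sprod; rewrite sz => H a b lta ltb.
rewrite -nthX //; apply: H => // c d ltc ltd; rewrite nthX; [exact: nzX | by [] | | ].
  exact: SX.
exact: leq_ltn_trans (leq_addr _ _) ltc.
Qed.

End Subfield.

(** * Regular functions and generic moves *)

Section Regular.

Variables (K : fieldType) (m n : nat).
Local Notation point := (nat -> nat -> K).
Implicit Types (X Y : point) (f g : point -> K) (t : K).

(** Rational expressions none of whose denominators vanishes at [x0]. Working by induction on the
    expression avoids quotients of polynomials in m n variables; [regular_ext] stands in for
    functional extensionality. *)
Inductive regular (x0 : point) : (point -> K) -> Prop :=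
| regular_ext f g : f =1 g -> regular x0 f -> regular x0 g
| regular_cst c : regular x0 (fun=> c)
| regular_coord a b : (a < m)%N -> (b < n)%N -> regular x0 (fun X => X a b)
| regularD f g : regular x0 f -> regular x0 g -> regular x0 (fun X => f X + g X)
| regularM f g : regular x0 f -> regular x0 g -> regular x0 (fun X => f X * g X)
| regularV f : regular x0 f -> f x0 != 0 -> regular x0 (fun X => (f X)^-1).

Lemma regularB x0 f g :
  regular x0 f -> regular x0 g -> regular x0 (fun X => f X - g X).
Proof.
move=> rf rg; apply: (@regular_ext _ (fun X => f X + (-1) * g X)).
  by move=> X; rewrite mulN1r.
by apply: regularD => //; apply: regularM => //; apply: regular_cst.
Qed.

Lemma regular_sum x0 I (r : seq I) (F : I -> point -> K) :
  (forall i, regular x0 (F i)) -> regular x0 (fun X => \sum_(i <- r) F i X).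
Proof.
move=> rF; elim: r => [|i r IHr].
  by apply: regular_ext (regular_cst _ 0) => X; rewrite big_nil.
by apply: regular_ext (regularD (rF i) IHr) => X; rewrite big_cons.
Qed.

Lemma regular_prod x0 (I : eqType) (r : seq I) (F : I -> point -> K) :
  (forall i, i \in r -> regular x0 (F i)) -> regular x0 (fun X => \prod_(i <- r) F i X).
Proof.
elim: r => [|i r IHr] rF.
  by apply: regular_ext (regular_cst _ 1) => X; rewrite big_nil.
have rFr : regular x0 (fun X => \prod_(j <- r) F j X).
  by apply: IHr => j jr; apply: rF; rewrite inE jr orbT.
apply: regular_ext (regularM (rF i (mem_head _ _)) rFr) => X.
by rewrite big_cons.
Qed.

(** Points are functions on all of nat, whereas identities such as [move_id] hold only inside the m
    x n range; regular functions do not see the difference. *)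
Lemma regular_local x0 f X Y : regular x0 f ->
    (forall a b, (a < m)%N -> (b < n)%N -> X a b = Y a b) ->
  f X = f Y.
Proof.
move=> rf eqXY; elim: rf => {f} [f g eqfg _|c|a b ltam ltbn|f g _ + _|f g _ + _|f _ + _].
- by rewrite !eqfg.
- by [].
- exact: eqXY.
- by move=> -> ->.
- by move=> -> ->.
by move=> ->.
Qed.

Lemma regular_comp x0 (T : point -> point) f :
    (forall a b, (a < m)%N -> (b < n)%N -> regular x0 (fun X => T X a b)) ->
  regular (T x0) f -> regular x0 (f \o T).
Proof.
move=> rT; elim=> {f} [f g eqfg _|c|a b ltam ltbn|f g _ + _|f g _ + _|f _ + nz].
- by apply: regular_ext => X /=; rewrite eqfg.
- exact: regular_cst.
- exact: rT.
- exact: regularD.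
- exact: regularM.
by move=> rf; apply: regularV.
Qed.

(** Agreement is required only off the roots of [q]: elsewhere [h] may involve the conventional
    inverse of 0. *)
Definition regular_curve t0 (h : K -> K) :=
  exists p q : {poly K}, q.[t0] != 0 /\ forall t, q.[t] != 0 -> h t = p.[t] / q.[t].

Lemma regular_curve_cst t0 c : regular_curve t0 (fun=> c).
Proof.
exists c%:P, 1; rewrite hornerC oner_neq0; split=> // t _.
by rewrite !hornerC divr1.
Qed.

Lemma regular_curve_id t0 : regular_curve t0 id.
Proof.
exists 'X, 1; rewrite hornerC oner_neq0; split=> // t _.
by rewrite hornerX hornerC divr1.
Qed.

Lemma regular_curveD t0 h k :
  regular_curve t0 h -> regular_curve t0 k -> regular_curve t0 (fun t => h t + k t).
Proof.
move=> [p [q [q0 hE]]] [p' [q' [q'0 kE]]]; exists (p * q' + p' * q), (q * q').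
rewrite !hornerE mulf_neq0 //; split=> // t; rewrite !hornerE mulf_eq0 => /norP[nq nq'].
by rewrite hE // kE //; field; rewrite nq nq'.
Qed.

Lemma regular_curveM t0 h k :
  regular_curve t0 h -> regular_curve t0 k -> regular_curve t0 (fun t => h t * k t).
Proof.
move=> [p [q [q0 hE]]] [p' [q' [q'0 kE]]]; exists (p * p'), (q * q').
rewrite !hornerE mulf_neq0 //; split=> // t; rewrite !hornerE mulf_eq0 => /norP[nq nq'].
by rewrite hE // kE //; field; rewrite nq nq'.
Qed.

Lemma regular_curveV t0 h :
  regular_curve t0 h -> h t0 != 0 -> regular_curve t0 (fun t => (h t)^-1).
Proof.
move=> [p [q [q0 hE]]]; rewrite hE // mulf_eq0 => /norP[p0 _].
(* The common factor [q] ensures that a non-root of the new denominator is a non-root of [q], where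
   the formula for [h] is available. *)
exists (q * q), (p * q); rewrite !hornerE mulf_neq0 //; split=> // t.
rewrite !hornerE mulf_eq0 => /norP[np nq].
by rewrite hE //; field; rewrite np nq.
Qed.

Lemma regular_curve_ext t0 h k :
  h =1 k -> regular_curve t0 h -> regular_curve t0 k.
Proof.
by move=> eqhk [p [q [q0 hE]]]; exists p, q; split=> // t nq; rewrite -eqhk hE.
Qed.

Lemma regular_curveB t0 h k :
  regular_curve t0 h -> regular_curve t0 k -> regular_curve t0 (fun t => h t - k t).
Proof.
move=> rh rk; have := regular_curveD rh (regular_curveM (regular_curve_cst t0 (-1)) rk).
by apply: regular_curve_ext => t; rewrite mulN1r.
Qed.

Lemma regular_curve_neq0 t0 h : regular_curve t0 h -> h t0 != 0 ->
  exists2 q : {poly K}, q != 0 & forall t, q.[t] != 0 -> h t != 0.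
Proof.
move=> [p [q [q0 hE]]]; rewrite hE // mulf_eq0 => /norP[p0 _].
exists (p * q); last first.
  move=> t; rewrite hornerM mulf_eq0 => /norP[np nq].
  by rewrite hE // mulf_neq0 ?invr_eq0.
apply/eqP => pq0; have := mulf_neq0 p0 q0; rewrite -hornerM pq0 horner0; by case/eqP.
Qed.

Lemma regular_on_curve t0 x0 (c : K -> point) f :
    (forall a b, (a < m)%N -> (b < n)%N -> c t0 a b = x0 a b) ->
    (forall a b, (a < m)%N -> (b < n)%N -> regular_curve t0 (fun t => c t a b)) ->
  regular x0 f -> regular_curve t0 (f \o c).
Proof.
move=> c0 rc; elim=> {f} [f g eqfg _|k|a b ltam ltbn|f g _ + _|f g _ + _|f rf + nz].
- by apply: regular_curve_ext => t /=.
- exact: regular_curve_cst.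
- exact: rc.
- exact: regular_curveD.
- exact: regular_curveM.
by move=> rfc; apply: regular_curveV => //=; rewrite (regular_local rf c0).
Qed.

(** An expression has finitely many denominators; each restricts to a rational function of [t] that
    is nonzero at [t0], so only finitely many [t] are bad. *)
Lemma regular_generic t0 x0 (c : K -> point) f :
    (forall a b, (a < m)%N -> (b < n)%N -> c t0 a b = x0 a b) ->
    (forall a b, (a < m)%N -> (b < n)%N -> regular_curve t0 (fun t => c t a b)) ->
    regular x0 f ->
  exists2 q : {poly K}, q != 0 & forall t, q.[t] != 0 -> regular (c t) f.
Proof.
move=> c0 rc.
elim=> {f} [f g eqfg _|k|a b ltam ltbn|f g _ + _|f g _ + _|f rf + nz].
- by case=> q nzq rq; exists q => // t /rq; apply: regular_ext.
- by exists 1; rewrite ?oner_neq0 // => t _; apply: regular_cst.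
- by exists 1; rewrite ?oner_neq0 // => t _; apply: regular_coord.
- move=> [q nzq rq] [q' nzq' rq']; exists (q * q'); rewrite ?mulf_neq0 // => t.
  by rewrite hornerM mulf_eq0 => /norP[/rq ? /rq' ?]; apply: regularD.
- move=> [q nzq rq] [q' nzq' rq']; exists (q * q'); rewrite ?mulf_neq0 // => t.
  by rewrite hornerM mulf_eq0 => /norP[/rq ? /rq' ?]; apply: regularM.
have := regular_curve_neq0 (regular_on_curve c0 rc rf).
rewrite /= (regular_local rf c0) => /(_ nz)[q nzq rq] [q' nzq' rq'].
exists (q * q'); rewrite ?mulf_neq0 // => t.
by rewrite hornerM mulf_eq0 => /norP[/rq ? /rq' ?]; apply: regularV.
Qed.

(* Row [i.+1] is determined by row [i], as moves preserve the products
   [X i b * X i.+1 b]. *)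
Definition move i (a : K) X : point := fun r b =>
  if r == i then etil (X i) (X i.+1) a b
  else if r == i.+1 then X i b * X i.+1 b / etil (X i) (X i.+1) a b
  else X r b.

Lemma move_row i (a : K) X : move i a X i = etil (X i) (X i.+1) a.
Proof. by rewrite /move eqxx. Qed.

Lemma move_other i (a : K) X r b : r != i -> r != i.+1 -> move i a X r b = X r b.
Proof. by rewrite /move => /negPf-> /negPf->. Qed.

Lemma move_id i X : (i.+1 < m)%N ->
    (forall a b, (a < m)%N -> (b < n)%N -> X a b != 0) ->
  forall a b, (a < m)%N -> (b < n)%N -> move i (X i 0%N) X a b = X a b.
Proof.
move=> ltim nzX a b ltam ltbn.
have e : etil (X i) (X i.+1) (X i 0%N) b = X i b.
  apply: etil_id => j ltjb; apply: nzX; [exact: ltnW | exact: ltn_trans ltbn].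
rewrite /move; case: eqVneq => [->//|_]; case: eqVneq => [->|//].
by rewrite e mulrAC mulfV ?mul1r // nzX // ltnW.
Qed.

(** This turns a move into an operator e_i^c with c in K. Since sigma^0 does not involve c, its
    nonvanishing can be stated for c = 1; that of the later sigma^j comes from the nonzero entries
    of the new row. *)
Lemma move_sig i (a : K) X : (0 < n)%N ->
    (forall b, (b < n)%N -> X i b != 0) -> sig n (X i) (X i.+1) 1 0 != 0 ->
    (forall b, (b < n)%N -> move i a X i b != 0) ->
  exists c, let s := sig n (X i) (X i.+1) c in
    (forall b, (b <= n)%N -> s b != 0) /\
    (forall r b, (b < n)%N -> move i a X r b =
      if r == i then X r b * s b.+1 / s b
      else if r == i.+1 then X r b * s b / s b.+1 else X r b).
Proof.
move=> n_gt0 nzX; rewrite move_row => nz0 nze.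
have [c cE] := exists_sig_param (X i.+1) a n_gt0 nzX; exists c => s.
have nzs0 : s 0%N != 0 by rewrite /s sig0 -(sig0 n (X i) (X i.+1) 1).
have sE := etil_sig nzX nze nzs0 cE.
have nzs b : (b <= n)%N -> s b != 0.
  case: b => [|b] // ltb; have [nzb eb] := sE b ltb.
  by apply: contraNneq (mulf_neq0 (nze b ltb) nzb) => s0; rewrite -eb [sig _ _ _ _ _]s0 mulr0.
split=> // r b ltb; have [nzb eb] := sE b ltb; have nzb1 := nzs b.+1 ltb.
rewrite /move; case: eqVneq => [->|_]; first by rewrite eb mulfK.
by case: eqVneq => [->|//]; apply: etil_sigV => //; apply: nze.
Qed.

Lemma bprod_move i (a : K) X : (i.+1 < m)%N ->
    (forall b, (b < n)%N -> move i a X i b != 0) ->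
  forall r s, (r < n)%N ->
    bprod (map (move i a X) (iota 0 m)) r s = bprod (map X (iota 0 m)) r s.
Proof.
move=> ltim; rewrite move_row => nze.
apply: (@eq_bprod_iota _ n i) => // [r b nri nri1 _|b ltb|b ltb].
- exact: move_other.
- by rewrite /move eqxx gtn_eqF // eqxx mulrC divfK ?nze.
by rewrite /move eqxx gtn_eqF // eqxx /= addrC subrK.
Qed.

Lemma regular_move x0 i (a : K) : (i.+1 < m)%N ->
    (forall b, (b < n)%N -> move i a x0 i b != 0) ->
  forall r b, (r < m)%N -> (b < n)%N -> regular x0 (fun X => move i a X r b).
Proof.
move=> ltim; rewrite move_row => nze.
have re b : (b < n)%N -> regular x0 (fun X => etil (X i) (X i.+1) a b).
  elim: b => [|b IHb] ltbn /=; first exact: regular_cst.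
  have ltb := ltnW ltbn; have ltim' := ltnW ltim.
  apply: regularB; first by apply: regularD; apply: regular_coord.
  apply: regularM; first by apply: regularM; apply: regular_coord.
  by apply: regularV; [apply: IHb | apply: nze].
move=> r b ltrm ltbn; rewrite /move; case: eqVneq => _; first exact: re.
case: eqVneq => _; last exact: regular_coord.
apply: regularM; first by apply: regularM; apply: regular_coord => //; apply: ltnW.
by apply: regularV; [apply: re | apply: nze].
Qed.

Lemma regular_curve_move X i : (i.+1 < m)%N ->
    (forall a b, (a < m)%N -> (b < n)%N -> X a b != 0) ->
  forall r b, (r < m)%N -> (b < n)%N ->
    regular_curve (X i 0%N) (fun t => move i t X r b).
Proof.
move=> ltim nzX; have nze b : (b < n)%N -> etil (X i) (X i.+1) (X i 0%N) b != 0.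
  by move=> ltbn; rewrite -move_row move_id ?nzX // ltnW.
have re b : (b < n)%N -> regular_curve (X i 0%N) (fun t => etil (X i) (X i.+1) t b).
  elim: b => [|b IHb] ltbn /=; first exact: regular_curve_id.
  apply: regular_curveB; first exact: regular_curve_cst.
  apply: regular_curveM; first exact: regular_curve_cst.
  by apply: regular_curveV; [apply: IHb | apply: nze]; apply: ltnW.
move=> r b ltrm ltbn; rewrite /move; case: eqVneq => _; first exact: re.
case: eqVneq => _; last exact: regular_curve_cst.
apply: regular_curveM; first exact: regular_curve_cst.
by apply: regular_curveV; [apply: re | apply: nze].
Qed.

(* [P] holds for generic l: each entry of [l] avoids the roots of a nonzero
   polynomial that may depend on the previous entries. *)
Fixpoint generic k (P : seq K -> Prop) : Prop :=
  if k is k'.+1 then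
    exists2 q : {poly K}, q != 0 & forall a, q.[a] != 0 -> generic k' (fun l => P (a :: l))
  else P [::].

Lemma generic_imp k (P Q : seq K -> Prop) :
  (forall l, P l -> Q l) -> generic k P -> generic k Q.
Proof.
elim: k P Q => [|k IHk] P Q PQ /=; first exact: PQ.
by case=> q nzq gP; exists q => // a /gP; apply: IHk => l; apply: PQ.
Qed.

Lemma generic_pick k P (S : K -> Prop) :
    (forall q : {poly K}, q != 0 -> exists2 a, S a & q.[a] != 0) ->
    generic k P -> exists2 l, P l & forall b, (b < k)%N -> S (nth 0 l b).
Proof.
move=> infS; elim: k P => [|k IHk] P /=; first by exists [::].
case=> q /infS[a Sa /[swap]/[apply]] /IHk[l Pl Sl].
by exists (a :: l) => // -[|b] //; apply: Sl.
Qed.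

(* In the recursion [etil u v], prescribing the values of [e] amounts to prescribing
   those of [v], and each [v b] is a nonconstant affine function of [e b.+1]. *)
Lemma generic_etil (u : nat -> K) k P j a : a != 0 -> a != u j -> generic k P ->
  generic k (fun l => exists2 l', P l' & forall v e, e j = a ->
    (forall b, (b < k)%N -> v (j + b)%N = nth 0 l' b) ->
    (forall b, e b.+1 = v b + u b.+1 - u b * v b / e b) ->
    forall b, (b <= k)%N -> e (j + b)%N = nth 0 (a :: l) b).
Proof.
elim: k P j a => [|k IHk] P j a nza nau /=.
  move=> P0; exists [::] => // v e ej _ _ b; rewrite leqn0 => /eqP->.
  by rewrite addn0.
(* The slope of e_(j+1) = v_j + u_(j+1) - u_j v_j / a as a function of v_j; it is nonzero since a
   differs from u_j. *)
case=> q nzq gP; pose s := 1 - u j / a.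
have nzs : s != 0.
  by rewrite subr_eq0 eq_sym; apply: contra nau => /eqP uja; rewrite -[u j](divfK nza) uja mul1r.
(* The inverse affine map, from the wanted value of e_(j+1) to the value of v_j. *)
pose w := s^-1 *: ('X - (u j.+1)%:P).
have szw : size w = 2%N by rewrite size_scale ?invr_eq0 // size_XsubC.
(* The factor [q \Po w] imposes the given genericity condition on v_j; the other two keep the next
   entry nonzero and different from u_(j+1), as the induction requires. *)
exists ((q \Po w) * ('X * ('X - (u j.+1)%:P))).
  rewrite !mulf_neq0 ?polyX_eq0 ?polyXsubC_eq0 //.
  by rewrite -size_poly_eq0 size_comp_poly2 // size_poly_eq0.
move=> a2; rewrite !hornerM !mulf_eq0 hornerX hornerXsubC subr_eq0.
rewrite horner_comp hornerZ hornerXsubC => /norP[/gP g2 /norP[nza2 na2u]].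
apply: generic_imp (IHk _ j.+1 a2 nza2 na2u g2) => l [l' Pl' H].
exists (s^-1 * (a2 - u j.+1) :: l') => // v e ej vE eE [|b] leb; first by rewrite addn0.
rewrite -addSnnS; apply: (H v) => // [|b' ltb'].
  rewrite eE ej; have := vE 0%N isT; rewrite addn0 /= => ->.
  have -> : forall x, x + u j.+1 - u j * x / a = s * x + u j.+1 by move=> x; rewrite /s; field.
  by rewrite mulVKf // subrK.
by rewrite addSnnS vE.
Qed.

End Regular.

(** * Nonvanishing conditions at a point *)

Section GoodPoints.

Variables (K : fieldType) (m n : nat) (Q : (nat -> nat -> K) -> K).

(** A single regular function gathers the conditions under which a move is an operator e_i^c at a
    point where the invariant function can be evaluated; [Q] will be the denominator of that
    function. The factor [sig] is sigma^0, which is the same for every c. *)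
Definition good (X : nat -> nat -> K) : K :=
  (\prod_(0 <= a < m) \prod_(0 <= b < n) X a b) *
  (\prod_(0 <= i < m.-1) sig n (X i) (X i.+1) 1 0) * Q X.

Lemma goodP X :
  reflect [/\ forall a b, (a < m)%N -> (b < n)%N -> X a b != 0,
              forall i, (i.+1 < m)%N -> sig n (X i) (X i.+1) 1 0 != 0 & Q X != 0]
          (good X != 0).
Proof.
rewrite /good !mulf_eq0 -orbA !negb_or !prodf_seq_neq0.
apply: (iffP and3P) => [[/allP nzX /allP nzs nzQ]|[nzX nzs nzQ]]; split=> //.
- move=> a b lta ltb; have := nzX a; rewrite mem_index_iota => /(_ lta).
  by rewrite prodf_seq_neq0 => /allP/(_ b); rewrite mem_index_iota => /(_ ltb).
- by move=> i ltim; apply: nzs; rewrite mem_index_iota ltn_predRL.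
- apply/allP => a; rewrite mem_index_iota => lta.
  rewrite prodf_seq_neq0; apply/allP => b; rewrite mem_index_iota => ltb.
  exact: nzX.
by apply/allP => i; rewrite mem_index_iota ltn_predRL => /nzs.
Qed.

Lemma regular_good X : (forall Y, regular m n Y Q) -> regular m n X good.
Proof.
move=> rQ; apply: regularM; last exact: rQ.
apply: regularM.
  apply: regular_prod => a; rewrite mem_index_iota => lta.
  by apply: regular_prod => b; rewrite mem_index_iota => ltb; apply: regular_coord.
apply: regular_prod => i; rewrite mem_index_iota ltn_predRL => ltim.
have rs r : (r < n)%N -> regular m n X (fun Y => sigterm n (Y i) (Y i.+1) r).
  move=> ltr; apply: regularM; apply: regular_prod => t; rewrite mem_index_iota.
    by move=> ltt; apply: regular_coord => //; apply: ltn_trans ltr.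
  by case/andP=> _ ltt; apply: regular_coord => //; apply: ltnW.
have rsum := @regular_sum _ _ _ X 'I_n _ (fun r Y => sigterm n (Y i) (Y i.+1) r)
  (fun r => rs r (ltn_ord r)).
apply: regular_ext (rsum (index_enum _)) => Y.
by rewrite sig0 big_mkord.
Qed.

End GoodPoints.

(** * Normal forms under the moves *)

Section NormalForm.

Variables (K : fieldType) (m n : nat).
Local Notation point := (nat -> nat -> K).

(** In the application, [conn X Y] says that [X] and [Y] have the same matrix product and give the
    invariant function the same value. *)
Variables (Q : point -> K) (conn : point -> point -> Prop).
Local Notation good := (good m n Q).
Hypothesis regular_Q : forall X, regular m n X Q.
Hypothesis conn_refl : forall X, conn X X.
Hypothesis conn_trans : forall X Y Z, conn X Y -> conn Y Z -> conn X Z.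
Hypothesis conn_move : forall X i a, (i.+1 < m)%N ->
  good X != 0 -> good (move i a X) != 0 -> conn X (move i a X).

Let regular_good X : regular m n X good.
Proof. exact: regular_good. Qed.

Let good_neq0 X a b : good X != 0 -> (a < m)%N -> (b < n)%N -> X a b != 0.
Proof. by case/goodP => nzX _ _; apply: nzX. Qed.

(* The prescribed values are chosen in the order opposite to that of the moves;
   this is possible since fixing the last move keeps the condition [Phi]
   regular and nonzero at the starting point. *)
Lemma generic_row k i X Phi : (i + k < m)%N -> (k <= n)%N ->
    regular m n X Phi -> Phi X != 0 -> good X != 0 ->
  generic k (fun l => exists Y, [/\ Phi Y != 0, good Y != 0, conn X Y,
    forall a b, (a < i)%N -> (b < n)%N -> Y a b = X a b &
    forall b, (b < k)%N -> Y i b = nth 0 l b]).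
Proof.
elim: k i Phi => [|k IHk] i Phi ltikm lekn rPhi nzPhi nzX /=; first by exists X.
have ltim : (i.+1 < m)%N by apply: leq_ltn_trans ltikm; rewrite addnS ltnS leq_addr.
have nzXe a b := good_neq0 nzX (a := a) (b := b).
have mid := move_id ltim nzXe.
have rc f : regular m n X f -> regular_curve (X i 0%N) (fun t => f (move i t X)).
  exact: (regular_on_curve mid (regular_curve_move ltim nzXe)).
have nz f : regular m n X f -> f X != 0 -> f (move i (X i 0%N) X) != 0.
  by move=> rf; rewrite (regular_local rf mid).
have [q1 nzq1 q1P] := regular_curve_neq0 (rc _ rPhi) (nz _ rPhi nzPhi).
have [q2 nzq2 q2P] := regular_curve_neq0 (rc _ (regular_good X)) (nz _ (regular_good X) nzX).
have [q3 nzq3 q3P] := regular_generic mid (regular_curve_move ltim nzXe) rPhi.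
(* The first three factors exclude the [a] for which [Phi] vanishes, goodness fails, or [Phi] may be
   irregular at the moved point. The last excludes the old entry, for which row [i] would stay
   unchanged whatever row [i.+1] is. *)
exists (q1 * q2 * q3 * ('X - (X i 0%N)%:P)); first by rewrite !mulf_neq0 ?polyXsubC_eq0.
move=> a; rewrite !hornerM !mulf_eq0 hornerXsubC subr_eq0 -orbA.
rewrite -orbA => /norP[/q1P nz1 /norP[/q2P nz2 /norP[/q3P rPm nau]]].
have nze b : (b < n)%N -> move i a X i b != 0 by apply: good_neq0 => //; apply: ltnW.
have nza : a != 0 by have := nze 0%N (leq_trans _ lekn); rewrite move_row; apply.
have rm : regular m n X ((fun Y => Phi Y * good Y) \o move i a).
  apply: regular_comp; first exact: regular_move.
  exact: regularM.
have := IHk i.+1 _ _ (ltnW lekn) rm _ nzX; rewrite addSnnS => /(_ ltikm).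
move=> /(_ (mulf_neq0 nz1 nz2)) /(generic_etil nza nau).
apply: generic_imp => l [l' [Z [/= + nzZ XZ ZX Zi]] H].
rewrite mulf_eq0 => /norP[nzPZ nzgZ]; exists (move i a Z); split=> //.
- exact/(conn_trans XZ)/conn_move.
- move=> r b ltri ltbn; rewrite move_other ?ltn_eqF // ?ltnS ?(ltnW ltri) //.
  by rewrite ZX // ltnW.
move=> b ltbk; rewrite move_row.
(* The earlier moves leave row [i] as in [X], so the recursion runs with the fixed row [X i] and
   with the entries of [Z i.+1] prescribed by induction. *)
have -> : etil (Z i) (Z i.+1) a b = etil (X i) (Z i.+1) a b.
  apply: eq_etil => // j lejb; apply: ZX => //.
  exact: leq_ltn_trans lejb (leq_trans ltbk lekn).
exact: (H (Z i.+1) (etil (X i) (Z i.+1) a)).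
Qed.

(** Rows are treated from the top down: the moves used for row r do not touch the rows above it. *)
Lemma exists_normal_form X (S : K -> Prop) :
    (forall q : {poly K}, q != 0 -> exists2 a, S a & q.[a] != 0) ->
    good X != 0 ->
  exists Y, [/\ good Y != 0, conn X Y &
    forall a b, (a + b.+1 < m)%N -> (b < n)%N -> S (Y a b)].
Proof.
move=> infS nzX; suff H r : (r <= m)%N -> exists Y, [/\ good Y != 0, conn X Y &
    forall a b, (a < r)%N -> (a + b.+1 < m)%N -> (b < n)%N -> S (Y a b)].
  have [Y [nzY XY SY]] := H m (leqnn m); exists Y; split=> // a b ltabm.
  by apply: (SY) => //; apply: leq_ltn_trans (leq_addr _ _) ltabm.
elim: r => [|r IHr] ltrm; first by exists X.
have [Y [nzY XY SY]] := IHr (ltnW ltrm).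
(* The condition r + b.+1 < m amounts to b < m - r.+1. *)
pose k := minn n (m - r.+1).
have ltrk : (r + k < m)%N.
  by rewrite -ltn_subRL; apply: leq_ltn_trans (geq_minr _ _) _; rewrite ltn_sub2l.
have := generic_row ltrk (geq_minl _ _) (regular_cst m n Y 1) (oner_neq0 _) nzY.
case/(generic_pick infS) => l [Z [_ nzZ YZ ZY Zr]] Sl.
exists Z; split=> //; first exact: conn_trans YZ.
move=> a b; rewrite ltnS leq_eqVlt => /orP[/eqP->|ltar] ltabm ltbn.
  have ltbk : (b < k)%N by rewrite leq_min ltbn ltn_subRL addSnnS.
  by rewrite Zr //; apply: Sl.
by rewrite ZY //; apply: SY.
Qed.

End NormalForm.

(** * Minors *)

Section Minors.

Variable R : comNzRingType.
Implicit Types (F G : nat -> nat -> R) (i k d : nat).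

Definition minor F i k : R := \det (\matrix_(r < k, s < k) F (i + r)%N s).

Lemma minor0 F i : minor F i 0 = 1.
Proof. exact: det_mx00. Qed.

Lemma eq_minor F G n i k : (i + k <= n)%N ->
  (forall r s, (r < n)%N -> F r s = G r s) -> minor F i k = minor G i k.
Proof.
move=> leikn eqFG; congr (\det _); apply/matrixP => r s; rewrite !mxE eqFG //.
by apply: leq_trans leikn; rewrite ltn_add2l.
Qed.

Lemma minor_trig F i k :
    (forall r s, (r < s < k)%N -> F (i + r)%N s = 0) ->
    (forall r, (r < k)%N -> F (i + r)%N r = 1) ->
  minor F i k = 1.
Proof.
move=> F0 F1; rewrite /minor det_trig.
  by rewrite big1 // => r _; rewrite mxE F1.
by apply/is_trig_mxP => r s ltrs; rewrite mxE F0 // ltrs ltn_ord.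
Qed.

Lemma minor_trig_tr F i k :
    (forall r s, (s < r)%N -> F (i + r)%N s = 0) ->
    (forall r, F (i + r)%N r = 1) ->
  minor F i k = 1.
Proof.
move=> F0 F1; rewrite /minor -det_tr det_trig.
  by rewrite big1 // => r _; rewrite !mxE F1.
by apply/is_trig_mxP => r s ltrs; rewrite !mxE F0.
Qed.

Lemma minor_bprod_edge l k : minor (bprod l) (size l) k = 1.
Proof.
apply: minor_trig_tr => [r s ltsr|r]; last by rewrite addnC bprod_edge.
by rewrite bprod_below // addnC ltn_add2l.
Qed.

Lemma minor_bprod_nseq01 d e k :
  minor (bprod (nseq d (fun=> 0) ++ nseq e (fun=> 1))) d k = 1.
Proof.
apply: minor_trig => [r s /andP[ltrs _]|r _]; rewrite bprod_nseq01 ?[(d + r)%N]addnC //.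
- by rewrite eqn_add2r ltn_eqF.
- by rewrite leq_add2r ltnW.
by rewrite eqxx.
Qed.

End Minors.

(** * Recovering matrix entries from ratios of minors *)

Section MinorsSubfield.

Variables (K : fieldType) (S : K -> Prop).
Hypothesis S1 : S 1.
Hypothesis SB : forall a b, S a -> S b -> S (a - b).
Hypothesis SM : forall a b, S a -> S b -> S (a * b).
Hypothesis SV : forall a, S a -> S a^-1.

(** Expansion along the last row: the larger minor is affine in its corner entry, with coefficient
    [minor F i k] and remaining terms in [S]. *)
Lemma subfield_corner k (F : nat -> nat -> K) i :
    (forall r s, (r <= k)%N -> (s <= k)%N -> (r, s) != (k, k) -> S (F (i + r)%N s)) ->
    S (minor F i k.+1) -> minor F i k != 0 ->
  S (F (i + k)%N k).
Proof.
move=> SF SD nzD; pose A : 'M[K]_k.+1 := \matrix_(r, s) F (i + r)%N s.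
have S0 := subfield0 S1 SB.
have cofE : cofactor A ord_max ord_max = minor F i k.
  rewrite /cofactor addnn -signr_odd odd_double mul1r; congr (\det _).
  by apply/matrixP => r s; rewrite !mxE !lift_max.
have Scof s : S (cofactor A ord_max s).
  apply: SM; first by apply: subfieldX => //; apply: subfieldN.
  apply: subfield_det => // r t; rewrite !mxE lift_max.
  apply: SF; first exact: ltnW.
    by rewrite -ltnS ltn_ord.
  by rewrite xpair_eqE negb_and ltn_eqF.
have DE : minor F i k.+1 = \det A by [].
move: SD; rewrite DE (expand_det_row A ord_max) (bigD1 ord_max) //= mxE cofE => SD.
set rest := \sum_(_ | _) _ in SD.
have Srest : S rest.
  apply: subfield_sum => // s nsk; apply: SM => //; rewrite mxE; apply: SF => //.
    by rewrite -ltnS ltn_ord.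
  by rewrite xpair_eqE eqxx.
have SDk : S (minor F i k).
  by rewrite -cofE.
have := SM (SB SD Srest) (SV SDk).
by rewrite addrK mulfK.
Qed.

Lemma subfield_bprod_minors n l :
    (forall i k, (i < size l)%N -> (i + k < n)%N ->
       S (minor (bprod l) i k.+1 / minor (bprod l) i.+1 k)) ->
    (forall i k, (i <= size l)%N -> (i + k <= n)%N -> minor (bprod l) i k != 0) ->
  forall r s, (r < n)%N -> S (bprod l r s).
Proof.
move=> Sz nzD; have S0 := subfield0 S1 SB.
(* The ratios telescope, passing from (i, k.+1) to (i.+1, k), down to an empty minor or to one with
   top row [size l], which is 1 by the band structure. *)
have SD k i : (i <= size l)%N -> (i + k <= n)%N -> S (minor (bprod l) i k).
  elim: k i => [|k IHk] i; first by rewrite minor0.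
  rewrite leq_eqVlt => /orP[/eqP-> _|ltil leikn]; first by rewrite minor_bprod_edge.
  have nz : minor (bprod l) i.+1 k != 0 by apply: nzD => //; rewrite addSnnS.
  rewrite -[minor _ _ _](divfK nz); apply: SM; first by apply: Sz => //; rewrite -addnS.
  by apply: IHk => //; rewrite addSnnS.
(* Columns, and rows within a column, are treated in increasing order: inside the band, entry (r, s)
   is the corner of the minor with top row r - s, whose other entries are already known. *)
move=> r s; elim/ltn_ind: s r => s IHs r; elim/ltn_ind: r => r IHr ltrn.
have [ltrs|lesr] := ltnP r s; first by rewrite bprod_upper.
have [lel|ltl] := leqP (size l) (r - s).
  move: lel; rewrite leq_subRL // leq_eqVlt => /orP[/eqP<-|lts].
    by rewrite bprod_edge.
  by rewrite bprod_below.
have rE : (r - s + s)%N = r by rewrite subnK.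
rewrite -rE; apply: subfield_corner.
- move=> r' s' ler les nrs.
  move: les; rewrite leq_eqVlt => /orP[/eqP s's|lts]; last first.
    apply: IHs => //; apply: leq_ltn_trans ltrn.
    by rewrite -[leqRHS]rE leq_add2l.
  rewrite s's; have ltr : (r - s + r' < r)%N.
    rewrite -[ltnRHS]rE ltn_add2l ltn_neqAle ler andbT.
    by apply: contra nrs => /eqP->; rewrite s's.
  by apply: IHr => //; apply: ltn_trans ltrn.
- by apply: SD; [apply: ltnW | rewrite addnS rE].
by apply: nzD; rewrite ?rE ltnW.
Qed.

End MinorsSubfield.

(** * Values of rational functions *)

Section Ratio.

Variables (A : idomainType) (L : fieldType) (phi : {rmorphism A -> L}).
Implicit Types (f g : {fraction A}) (y z : L) (p q : A).

(* [f] is defined at the [L]-point [phi], with value [y] there. *)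
Definition has_value f y : Prop :=
  exists p q, [/\ phi q != 0, f = p%:F / q%:F & y = phi p / phi q].

Lemma tofrac_den_neq0 q : phi q != 0 -> q%:F != 0.
Proof. by rewrite tofrac_eq0; apply: contraNneq => ->; rewrite rmorph0. Qed.

Lemma has_value_inj f y z : has_value f y -> has_value f z -> y = z.
Proof.
move=> [p [q [nzq -> ->]]] [p' [q' [nzq' /eqP + ->]]].
rewrite (eqr_div _ _ (tofrac_den_neq0 nzq) (tofrac_den_neq0 nzq')) -!rmorphM tofrac_eq => /eqP e.
by apply/eqP; rewrite eqr_div // -!rmorphM e.
Qed.

Lemma has_value_frac p : has_value p%:F (phi p).
Proof. by exists p, 1; rewrite !rmorph1 oner_neq0 !divr1. Qed.

Lemma has_value1 : has_value 1 1.
Proof. by rewrite -(rmorph1 (@tofrac A)) -(rmorph1 phi); apply: has_value_frac. Qed.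

Lemma has_value0 : has_value 0 0.
Proof. by rewrite -(rmorph0 (@tofrac A)) -(rmorph0 phi); apply: has_value_frac. Qed.

Lemma has_valueD f g y z : has_value f y -> has_value g z -> has_value (f + g) (y + z).
Proof.
move=> [p [q [nzq -> ->]]] [p' [q' [nzq' -> ->]]].
exists (p * q' + p' * q), (q * q'); rewrite rmorphM mulf_neq0 //; split=> //.
  by rewrite rmorphD !rmorphM addf_div ?tofrac_den_neq0.
by rewrite rmorphD !rmorphM addf_div.
Qed.

Lemma has_valueM f g y z : has_value f y -> has_value g z -> has_value (f * g) (y * z).
Proof.
move=> [p [q [nzq -> ->]]] [p' [q' [nzq' -> ->]]].
by exists (p * p'), (q * q'); rewrite !rmorphM mulf_neq0 // !mulf_div.
Qed.

Lemma has_valueN f y : has_value f y -> has_value (- f) (- y).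
Proof.
by move=> [p [q [nzq -> ->]]]; exists (- p), q; rewrite !rmorphN !mulNr.
Qed.

Lemma has_valueB f g y z : has_value f y -> has_value g z -> has_value (f - g) (y - z).
Proof. by move=> fy gz; apply: has_valueD => //; apply: has_valueN. Qed.

Lemma has_valueV f y : has_value f y -> y != 0 -> has_value f^-1 y^-1.
Proof.
move=> [p [q [nzq -> ->]]]; rewrite mulf_eq0 => /norP[nzp _].
by exists q, p; rewrite !invf_div.
Qed.

Lemma has_value_div f g y z :
  has_value f y -> has_value g z -> z != 0 -> has_value (f / g) (y / z).
Proof. by move=> fy gz nzz; apply: has_valueM => //; apply: has_valueV. Qed.

Lemma has_valueX f y k : has_value f y -> has_value (f ^+ k) (y ^+ k).
Proof.
move=> fy; elim: k => [|k IHk]; first exact: has_value1.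
by rewrite !exprS; apply: has_valueM.
Qed.

Lemma has_value_sum I (r : seq I) (P : pred I) (F : I -> {fraction A}) (G : I -> L) :
    (forall i, P i -> has_value (F i) (G i)) ->
  has_value (\sum_(i <- r | P i) F i) (\sum_(i <- r | P i) G i).
Proof.
move=> FG; apply: (big_ind2 has_value) => //; first exact: has_value0.
by move=> ? ? ? ?; apply: has_valueD.
Qed.

Lemma has_value_prod I (r : seq I) (P : pred I) (F : I -> {fraction A}) (G : I -> L) :
    (forall i, P i -> has_value (F i) (G i)) ->
  has_value (\prod_(i <- r | P i) F i) (\prod_(i <- r | P i) G i).
Proof.
move=> FG; apply: (big_ind2 has_value) => //; first exact: has_value1.
by move=> ? ? ? ?; apply: has_valueM.
Qed.

(** Explicit rational functions are shown to be nonzero in this way, by exhibiting one point with a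
    nonzero value. *)
Lemma has_value_neq0 f y : has_value f y -> y != 0 -> f != 0.
Proof.
move=> fy; apply: contraNneq => f0; rewrite f0 in fy.
by rewrite (has_value_inj fy has_value0).
Qed.

Lemma has_value_bprod n l (X : nat -> nat -> {fraction A}) (Y : nat -> nat -> L) :
    (forall a b, a \in l -> (b < n)%N -> has_value (X a b) (Y a b)) ->
  forall r s, (r < n)%N -> has_value (bprod (map X l) r s) (bprod (map Y l) r s).
Proof.
elim: l => [|a l IHl] XY r s ltrn /=.
  by case: eqP => _; [exact: has_value1 | exact: has_value0].
have IH r' : (r' < n)%N -> has_value (bprod (map X l) r' s) (bprod (map Y l) r' s).
  by apply: IHl => a' b la'; apply: XY; rewrite inE la' orbT.
apply: has_valueD; first by apply: has_valueM; [apply: XY; rewrite ?mem_head | apply: IH].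
by case: r ltrn => [|r] ltrn; [exact: has_value0 | apply/IH/ltnW].
Qed.

Lemma has_value_minor (F : nat -> nat -> {fraction A}) (G : nat -> nat -> L) n i k :
    (i + k <= n)%N ->
    (forall r s, (r < n)%N -> has_value (F r s) (G r s)) ->
  has_value (minor F i k) (minor G i k).
Proof.
move=> leikn FG; apply: has_value_sum => p _; apply: has_valueM.
  by apply: has_valueX; apply/has_valueN/has_value1.
apply: has_value_prod => r _; rewrite !mxE; apply: FG.
by apply: leq_trans leikn; rewrite ltn_add2l.
Qed.

Lemma has_value_sig n u v c u' v' c' j : (j <= n)%N ->
    (forall b, (b < n)%N -> has_value (u b) (u' b)) ->
    (forall b, (b < n)%N -> has_value (v b) (v' b)) ->
    has_value c c' ->
  has_value (sig n u v c j) (sig n u' v' c' j).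
Proof.
move=> lejn uu' vv' cc'.
have st r : (r < n)%N -> has_value (sigterm n u v r) (sigterm n u' v' r).
  move=> ltrn; rewrite /sigterm !big_nat; apply: has_valueM; apply: has_value_prod => t.
    by move=> /andP[_ ltt]; apply/vv'/(ltn_trans ltt).
  by move=> /andP[_ ltt]; apply/uu'.
rewrite /sig; apply: has_valueD.
  by rewrite !big_nat; apply: has_value_sum => r /andP[_]; apply: st.
apply: has_valueM; first by apply: has_valueB => //; apply: has_value1.
rewrite !big_nat; apply: has_value_sum => r /andP[_ ltrj].
exact/st/(leq_trans ltrj).
Qed.

End Ratio.

(** Ties [f] to the chosen representative into which [rcomp] substitutes. *)
Lemma frac_repr (A : idomainType) (f : {fraction A}) :
  f = (frac (repr f)).1%:F / (frac (repr f)).2%:F.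
Proof.
have nzd : (frac (repr f)).2%:F != 0 by rewrite tofrac_eq0 denom_ratioP.
apply: (mulIf nzd); rewrite divfK // -{1}[f]reprK; unlock tofrac.
rewrite -[LHS]FracField.pi_mul; apply/eqmodP; rewrite /= FracField.equivfE.
by rewrite /FracField.mulf !numden_Ratio ?mulf_neq0 ?oner_neq0 ?denom_ratioP // !mulr1 mulrC.
Qed.

(** * The invariant field *)

Section PointMatrix.

Variables (T : nmodType) (m n : nat).

Definition mxpoint (g : 'M[T]_(m, n)) (a b : nat) : T :=
  if (insub a, insub b) is (Some a', Some b') then g a' b' else 0.

Definition pointmx (X : nat -> nat -> T) : 'M[T]_(m, n) := \matrix_(a, b) X a b.

Lemma mxpointE (g : 'M[T]_(m, n)) (a : 'I_m) (b : 'I_n) : mxpoint g a b = g a b.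
Proof. by rewrite /mxpoint !valK. Qed.

Lemma mxvec_pointmx X (a : 'I_m) (b : 'I_n) : mxvec (pointmx X) 0 (mxvec_index a b) = X a b.
Proof. by rewrite mxvecE mxE. Qed.

End PointMatrix.

Lemma has_value_mmap (A : idomainType) (L : fieldType) (phi : {rmorphism A -> L})
    N (T : nzRingType) (h : T -> {fraction A}) (h' : T -> L) (v : 'I_N -> {fraction A}) v' p :
    (forall c, has_value phi (h c) (h' c)) -> (forall k, has_value phi (v k) (v' k)) ->
  has_value phi (mmap h v p) (mmap h' v' p).
Proof.
move=> hh' vv'; apply: has_value_sum => t _; apply: has_valueM => //.
by apply: has_value_prod => k _; apply: has_valueX.
Qed.

Section Interface.

Variables (R : realType) (m n : nat).
Local Notation C := (complex R).
Local Notation K := (Kx R m n).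
Local Notation Kc := (Kxc R m n).
Local Notation cst := (@tofrac {mpoly C[m * n]} \o @mpolyC (m * n) C).
Local Notation cstc := (@tofrac {mpoly C[(m * n).+1]} \o @mpolyC (m * n).+1 C).

Local Notation rows X := (map X (iota 0 m)).

Definition xpoint : nat -> nat -> K := mxpoint (\matrix_(a, b) xvar R a b).
Definition ypoint : nat -> nat -> Kc := mxpoint (id_img R m n).

Lemma sigmaE (u v : nat -> Kc) c j : (j <= n)%N ->
  sigma (fun b : 'I_n => u b) (fun b : 'I_n => v b) c j = sig n u v c j.
Proof.
move=> lejn; rewrite /sigma /sig.
have stE (r : 'I_n) : sigterm n u v r =
    (\prod_(t < n | (t < r)%N) v t) * (\prod_(t < n | (r < t)%N) u t).
  rewrite /sigterm big_mkord (big_ord_widen n v (ltnW (ltn_ord r))).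
  by rewrite (big_geq_mkord _ _ predT).
rewrite !big_mkord (big_ord_widen n (sigterm n u v) lejn) [X in _ * X]big_mkcond /=.
rewrite mulr_sumr -big_split /=; apply: eq_bigr => r _.
rewrite -mulrA -stE; case: ifP => _; ring.
Qed.

Definition sigc i j := sig n (ypoint i) (ypoint i.+1) (cvar R m n) j.

Lemma yrowE a (b : 'I_n) : yrow R m a b = ypoint a b.
Proof.
rewrite /yrow /ypoint /mxpoint valK; case: insubP => [a' _ _|//].
by rewrite mxE.
Qed.

Definition epoint i : nat -> nat -> Kc := mxpoint (e_img R m n i).

Lemma epointE i a b : (a < m)%N -> (b < n)%N ->
  epoint i a b = if a == i then ypoint a b * sigc i b.+1 / sigc i b
                 else if a == i.+1 then ypoint a b * sigc i b / sigc i b.+1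
                 else ypoint a b.
Proof.
move=> lta ltb; rewrite /epoint -[a]/(val (Ordinal lta)) -[b]/(val (Ordinal ltb)).
rewrite mxpointE /ypoint mxpointE !mxE /= /sigc.
have sE j : (j <= n)%N -> sigma (yrow R m i) (yrow R m i.+1) (cvar R m n) j = sigc i j.
  move=> lejn; rewrite /sigc -sigmaE //; apply: eq_bigr => r _.
  by congr (_ * _ * _); apply: eq_bigr => t _; rewrite yrowE.
by rewrite !sE // ltnW.
Qed.

Lemma MmxE (r s : 'I_n) : Mmx R m n r s = bprod (rows xpoint) r s.
Proof.
rewrite /Mmx -val_enum_ord -map_comp; elim: (enum 'I_m) r => [|a l IHl] r /=.
  by rewrite mxE.
rewrite mxE (bigD1 r) //= mxE eqxx IHl; congr (_ * _ + _).
  by rewrite /xpoint mxpointE mxE.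
case Er: (val r) => [|r'].
  rewrite big1 // => q nqr; rewrite mxE eq_sym (negPf nqr) Er /=; exact: mul0r.
have ltr' : (r' < n)%N by have := ltn_ord r; rewrite [X in (X < _)%N -> _]Er; apply: ltnW.
rewrite (bigD1 (Ordinal ltr')) /=; last by rewrite -val_eqE /= Er ltn_eqF.
rewrite mxE -val_eqE /= Er gtn_eqF // eqxx mul1r IHl big1 ?addr0 // => q.
case/andP=> nqr nqr'; rewrite mxE eq_sym (negPf nqr) Er eqSS.
case: eqP => [r'q|_]; last exact: mul0r.
by case/eqP: nqr'; apply: val_inj.
Qed.

Lemma entry_Mmx r s : (r < n)%N -> (s < n)%N ->
  entry (Mmx R m n) r s = bprod (rows xpoint) r s.
Proof. by move=> ltr lts; rewrite /entry !insubT MmxE. Qed.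

Lemma DeltaE i j : (0 < i)%N -> (j <= n)%N ->
  Delta (Mmx R m n) i j = minor (bprod (rows xpoint)) i.-1 (j.+1 - i).
Proof.
case: i => [//|i] _ lejn; rewrite /Delta /minor; congr (\det _); apply/matrixP => r s.
have lts (t : 'I_(j.+1 - i.+1)) : (t < n - i)%N.
  by apply: leq_trans (ltn_ord t) _; rewrite subSS leq_sub2r.
rewrite !mxE entry_Mmx //; first by rewrite -ltn_subRL.
exact: leq_trans (lts s) (leq_subr _ _).
Qed.

Definition peval (X : nat -> nat -> K) : {mpoly C[m * n]} -> K :=
  mmap cst (mxvec (pointmx m n X) 0).

Lemma has_value_xpoint (Y : nat -> nat -> C) a b : (a < m)%N -> (b < n)%N ->
  has_value (meval (mxvec (pointmx m n Y) 0)) (xpoint a b) (Y a b).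
Proof.
move=> lta ltb; rewrite /xpoint -[a]/(val (Ordinal lta)) -[b]/(val (Ordinal ltb)).
rewrite mxpointE mxE /= -(mxvec_pointmx Y (Ordinal lta) (Ordinal ltb)).
rewrite -(mevalXU (mxvec (pointmx m n Y) 0)).
exact: has_value_frac.
Qed.

(** At the generic point, evaluation is the embedding of polynomials into C(x), so no nonzero
    polynomial vanishes there. *)
Lemma peval_xpoint p : peval xpoint p = p%:F.
Proof.
rewrite [in RHS](mpolyE p) rmorph_sum /=; apply: eq_bigr => t _.
rewrite -mul_mpolyC rmorphM mpolyXE_id rmorph_prod; congr (_ * _).
apply: eq_bigr => k _; rewrite rmorphXn; congr (_ ^+ _).
by case/mxvec_indexP: k => a b; rewrite mxvec_pointmx /xpoint mxpointE mxE.
Qed.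

Lemma xpoint_neq0 a b : (a < m)%N -> (b < n)%N -> xpoint a b != 0.
Proof.
move=> lta ltb; apply: has_value_neq0 (has_value_xpoint (fun _ _ => 1) lta ltb) _.
exact: oner_neq0.
Qed.

(** At the point with all entries 1, sigma^0 has the value n, nonzero in characteristic 0. *)
Lemma sig_xpoint_neq0 i : (0 < n)%N -> (i.+1 < m)%N ->
  sig n (xpoint i) (xpoint i.+1) 1 0 != 0.
Proof.
move=> n_gt0 ltim; have ltim' := ltnW ltim.
have hv a b (lta : (a < m)%N) (ltb : (b < n)%N) := has_value_xpoint (fun _ _ => 1) lta ltb.
have hs := has_value_sig (leq0n n) (fun b => hv i b ltim') (fun b => hv i.+1 b ltim) (has_value1 _).
apply: has_value_neq0 hs _; rewrite sig0.
have -> : \sum_(0 <= r < n) sigterm n (fun=> 1) (fun=> 1) r = n%:R :> C.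
  rewrite (eq_bigr (fun=> 1)) => [|r _]; first by rewrite sumr_const_nat subn0.
  by rewrite /sigterm !big1 ?mulr1.
by rewrite pnatr_eq0 -lt0n.
Qed.

Lemma minor_xpoint_neq0 i k : (i <= m)%N -> (i + k <= n)%N ->
  minor (bprod (rows xpoint)) i k != 0.
Proof.
(* With the first [i] rows 0 and the others 1, the submatrix with top row [i] is lower triangular
   with unit diagonal, so the minor is 1. *)
move=> leim leikn; pose Y a : nat -> C := if (a < i)%N then fun=> 0 else fun=> 1.
have hm : has_value (meval (mxvec (pointmx m n Y) 0))
    (minor (bprod (rows xpoint)) i k) (minor (bprod (rows Y)) i k).
  apply: has_value_minor leikn _; apply: has_value_bprod => a b.
  by rewrite mem_iota => lta ltb; apply: has_value_xpoint.
apply: has_value_neq0 hm _.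
have map_nseq (y : nat -> C) (t : seq nat) :
    (forall a, a \in t -> Y a = y) -> map Y t = nseq (size t) y.
  elim: t => //= a t IHt Yy; rewrite Yy ?mem_head ?IHt // => a' ta'.
  by apply: Yy; rewrite inE ta' orbT.
rewrite -(subnKC leim) iotaD map_cat (map_nseq (fun=> 0)); last first.
  by move=> a; rewrite mem_iota /Y /= add0n => ->.
rewrite (map_nseq (fun=> 1)) => [|a]; last first.
  by rewrite mem_iota add0n /Y => /andP[leia _]; rewrite ltnNge leia.
by rewrite !size_iota minor_bprod_nseq01 oner_neq0.
Qed.

(** * Specialisation of x and c in K *)

Section AtPoint.

Variables (X : nat -> nat -> K) (c : K).

(** The variable c has index m n, on which [insub] fails, so that [oapp] returns its default [c]. *)
Definition xceval : {mpoly C[(m * n).+1]} -> K :=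
  mmap cst (fun k => oapp (mxvec (pointmx m n X) 0) c (insub (k : nat))).
HB.instance Definition _ := GRing.RMorphism.on xceval.

Lemma has_value_ypoint a b : (a < m)%N -> (b < n)%N ->
  has_value xceval (ypoint a b) (X a b).
Proof.
move=> lta ltb; rewrite /ypoint -[a]/(val (Ordinal lta)) -[b]/(val (Ordinal ltb)).
rewrite mxpointE mxE /= -(mxvec_pointmx X (Ordinal lta) (Ordinal ltb)).
have -> : mxvec (pointmx m n X) 0 (mxvec_index (Ordinal lta) (Ordinal ltb)) =
    xceval 'X_(widen_ord (leqnSn _) (mxvec_index (Ordinal lta) (Ordinal ltb))).
  by rewrite /xceval mmapX mmap1U; rewrite /= (valK (mxvec_index (Ordinal lta) (Ordinal ltb))).
exact: has_value_frac.
Qed.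

Lemma has_value_cvar : has_value xceval (cvar R m n) c.
Proof.
have -> : c = xceval 'X_ord_max by rewrite /xceval mmapX mmap1U /= insubF ?ltnn.
exact: has_value_frac.
Qed.

Lemma has_value_sigc i j : (i.+1 < m)%N -> (j <= n)%N ->
  has_value xceval (sigc i j) (sig n (X i) (X i.+1) c j).
Proof.
move=> ltim lejn; apply: has_value_sig => // [b ltb|b ltb|].
- by apply: has_value_ypoint => //; apply: ltnW.
- exact: has_value_ypoint.
exact: has_value_cvar.
Qed.

Lemma has_value_psubst g (Y : nat -> nat -> K) p :
    (forall a b, (a < m)%N -> (b < n)%N -> has_value xceval (mxpoint g a b) (Y a b)) ->
  has_value xceval (psubst g p) (peval Y p).
Proof.
move=> gY; apply: has_value_mmap => [k|k].
  have -> : (cst k) = xceval k%:MP by rewrite /xceval mmapC.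
  exact: has_value_frac.
case/mxvec_indexP: k => a b; rewrite mxvec_pointmx mxvecE -mxpointE.
exact: gY.
Qed.

Lemma has_value_psubst_id p :
  has_value xceval (psubst (id_img R m n) p) (peval X p).
Proof. by apply: has_value_psubst => a b; apply: has_value_ypoint. Qed.

Lemma has_value_epoint i Y : (i.+1 < m)%N ->
    (forall b, (b <= n)%N -> sig n (X i) (X i.+1) c b != 0) ->
    (forall a b, (a < m)%N -> (b < n)%N -> Y a b =
      if a == i then X a b * sig n (X i) (X i.+1) c b.+1 / sig n (X i) (X i.+1) c b
      else if a == i.+1 then X a b * sig n (X i) (X i.+1) c b / sig n (X i) (X i.+1) c b.+1
      else X a b) ->
  forall a b, (a < m)%N -> (b < n)%N -> has_value xceval (epoint i a b) (Y a b).
Proof.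
move=> ltim nzs YE a b lta ltb; rewrite epointE // YE //.
have ltbn := ltnW ltb; have hX := has_value_ypoint lta ltb.
case: ifP => _; last case: ifP => _ //.
all: do ?apply: has_value_div => //; do ?apply: has_valueM => //.
all: by try exact: has_value_sigc; apply: nzs.
Qed.

End AtPoint.

Lemma sigc_neq0 i j : (0 < n)%N -> (i.+1 < m)%N -> (j <= n)%N -> sigc i j != 0.
Proof.
move=> n_gt0 ltim lejn; have hs := has_value_sigc xpoint 1 ltim lejn.
apply: has_value_neq0 hs _; rewrite /sig subrr mul0r addr0.
rewrite -(sig0 n (xpoint i) (xpoint i.+1) 1).
exact: sig_xpoint_neq0.
Qed.

Lemma psubst_id_neq0 p : p != 0 -> psubst (id_img R m n) p != 0.
Proof.
move=> nzp; apply: has_value_neq0 (has_value_psubst_id xpoint 1 p) _.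
by rewrite peval_xpoint tofrac_eq0.
Qed.

(** For c = 1 all sigma^j coincide and e_i^c is the identity; so the substituted polynomial takes
    the value p at (x, 1) and cannot be 0. *)
Lemma psubst_e_neq0 i p : (0 < n)%N -> (i.+1 < m)%N -> p != 0 ->
  psubst (e_img R m n i) p != 0.
Proof.
move=> n_gt0 ltim nzp.
have s1 b : sig n (xpoint i) (xpoint i.+1) 1 b = sig n (xpoint i) (xpoint i.+1) 1 0.
  by rewrite sig0 /sig subrr mul0r addr0.
have nzs b : sig n (xpoint i) (xpoint i.+1) 1 b != 0 by rewrite s1 sig_xpoint_neq0.
have he : has_value (xceval xpoint 1) (psubst (e_img R m n i) p) (peval xpoint p).
  apply: has_value_psubst; apply: has_value_epoint => // a b _ _.
  by rewrite (s1 b) (s1 b.+1) mulfK ?sig_xpoint_neq0 //; do 2?case: ifP.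
by apply: has_value_neq0 he _; rewrite peval_xpoint tofrac_eq0.
Qed.

(** * Substitution as a field morphism *)

Section Composition.

Variable g : 'M[Kc]_(m, n).
Hypothesis psubst_neq0 : forall p, p != 0 -> psubst g p != 0.
Local Notation phi := (mmap cstc (mxvec g 0)).

(** No nonzero denominator is sent to 0, so [rcomp g f] is a value of [f], independent of the
    representative; compatibility with the field operations then follows from uniqueness of
    values. *)
Lemma rcompP f : has_value phi f (rcomp g f).
Proof.
exists (frac (repr f)).1, (frac (repr f)).2; split=> //; last exact: frac_repr.
exact/psubst_neq0/denom_ratioP.
Qed.

Lemma rcompE f y : has_value phi f y -> rcomp g f = y.
Proof. exact/has_value_inj/rcompP. Qed.

Lemma rcomp_eq0 f : rcomp g f = 0 -> f = 0.
Proof.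
have [p [q [nzq -> ->]]] := rcompP f => /eqP; rewrite mulf_eq0 invr_eq0 (negPf nzq) orbF.
have [->|/psubst_neq0/negPf nzp] := eqVneq p 0; first by rewrite rmorph0 mul0r.
by rewrite [_ == _]nzp.
Qed.

Lemma rcompC c : rcomp g (cst c) = cstc c.
Proof. by apply: rcompE; rewrite -(mmapC (mxvec g 0) cstc c); apply: has_value_frac. Qed.

Lemma rcompB f1 f2 : rcomp g (f1 - f2) = rcomp g f1 - rcomp g f2.
Proof. by apply: rcompE; apply: has_valueB; apply: rcompP. Qed.

Lemma rcompM f1 f2 : rcomp g (f1 * f2) = rcomp g f1 * rcomp g f2.
Proof. by apply: rcompE; apply: has_valueM; apply: rcompP. Qed.

Lemma rcompV f : rcomp g f^-1 = (rcomp g f)^-1.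
Proof.
have [f0|nzf] := eqVneq (rcomp g f) 0.
  by rewrite f0 (rcomp_eq0 f0) !invr0 -(rcomp_eq0 f0) f0.
by apply: rcompE; apply: has_valueV => //; apply: rcompP.
Qed.

Lemma rcomp_minor i k : (i + k <= n)%N ->
  rcomp g (minor (bprod (rows xpoint)) i k) = minor (bprod (rows (mxpoint g))) i k.
Proof.
move=> leikn; apply: rcompE; apply: has_value_minor leikn _.
apply: has_value_bprod => a b; rewrite mem_iota => lta ltb.
rewrite /xpoint -[a]/(val (Ordinal lta)) -[b]/(val (Ordinal ltb)) !mxpointE mxE.
have -> : g (Ordinal lta) (Ordinal ltb) = phi 'X_(mxvec_index (Ordinal lta) (Ordinal ltb)).
  by rewrite mmapX mmap1U mxvecE.
exact: has_value_frac.
Qed.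

End Composition.

Lemma bprod_epoint i : (0 < n)%N -> (i.+1 < m)%N -> forall r s, (r < n)%N ->
  bprod (rows (epoint i)) r s = bprod (rows ypoint) r s.
Proof.
move=> n_gt0 ltim; have ltim' := ltnW ltim.
have nzs b : (b <= n)%N -> sigc i b != 0 by apply: sigc_neq0.
apply: (@eq_bprod_iota _ n i) => // [a b /negPf nai /negPf nai1 ltb|b ltb|b ltb].
- have [lta|lema] := ltnP a m; first by rewrite epointE // nai nai1.
  by rewrite /epoint /ypoint /mxpoint insubF // ltnNge lema.
- rewrite !epointE // !eqxx gtn_eqF //.
  by apply: sig_swapM; apply: nzs => //; apply: ltnW.
rewrite !epointE ?(ltnW ltb) // !eqxx gtn_eqF //.
by apply: sig_swapD => //; apply/nzs/ltnW.
Qed.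

(** * The two inclusions *)

Section Invariants.

Hypothesis n_gt0 : (0 < n)%N.

Lemma gen_subfield_Inv_e (f : K) : gen_subfield (@z_gens R m n) f -> Inv_e f.
Proof.
move=> Sf i ltim; pose nze p := @psubst_e_neq0 i p n_gt0 ltim.
pose nzid p := @psubst_id_neq0 p.
(* The subfield [S] is taken to be the set of functions fixed by this one e_i. *)
pattern f; apply: Sf => [c|_ [r [j [/andP[r_gt0 lerm] /andP[lerj lejn] ->]]]|a b|a b|a].
- by rewrite [LHS](rcompC nze) [RHS](rcompC nzid).
- have ler : (r.-1 + (j.+1 - r) <= n)%N.
    by rewrite -ltnS -addSn prednK // subnKC // ltnW.
  have ler' : (r + (j.+1 - r.+1) <= n)%N by rewrite subSS subnKC.
  rewrite /z !DeltaE // !(rcompM nze) !(rcompM nzid) !(rcompV nze) !(rcompV nzid).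
  rewrite !(rcomp_minor nze) // !(rcomp_minor nzid) //.
  by congr (_ / _); apply: (@eq_minor _ _ _ n) => // r' s; apply: bprod_epoint.
- by move=> ea eb; rewrite (rcompB nze) (rcompB nzid) ea eb.
- by move=> ea eb; rewrite (rcompM nze) (rcompM nzid) ea eb.
by move=> ea; rewrite (rcompV nze) (rcompV nzid) ea.
Qed.

Section Converse.

Variable f : K.
Hypothesis f_inv : Inv_e f.
Let p := (frac (repr f)).1.
Let q := (frac (repr f)).2.

Local Notation good := (good m n (fun X => peval X q)).

Let conn (X Y : nat -> nat -> K) : Prop :=
  (forall r s, (r < n)%N -> bprod (rows Y) r s = bprod (rows X) r s) /\
  peval Y p / peval Y q = peval X p / peval X q.

Let regular_peval X g : regular m n X (fun Y => peval Y g).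
Proof.
apply: regular_sum => t; apply: regularM; first exact: regular_cst.
apply: regular_prod => k _.
have rk : regular m n X (fun Y => mxvec (pointmx m n Y) 0 k).
  case/mxvec_indexP: k => a b.
  by apply: regular_ext (regular_coord _ (ltn_ord a) (ltn_ord b)) => Y; rewrite mxvec_pointmx.
elim: (t k) => [|e IHe]; first exact: regular_cst.
by apply: regular_ext (regularM rk IHe) => Y; rewrite exprS.
Qed.

(** The identity of invariance is specialised at (X, c), with c given by [move_sig]: its two sides
    take the values f(Y) and f(X), both defined because X and Y are good, and a value is unique. *)
Let conn_move X i a : (i.+1 < m)%N ->
  good X != 0 -> good (move i a X) != 0 -> conn X (move i a X).
Proof.
move=> ltim gX gY; have ltim' := ltnW ltim; set Y := move i a X.
case/goodP: (gX) => ntX nsX nqX; case/goodP: (gY) => ntY _ nqY.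
have nzX b : (b < n)%N -> X i b != 0 by apply: ntX.
have nzY b : (b < n)%N -> Y i b != 0 by apply: ntY.
split; first exact: bprod_move.
have [c [nzs YE]] := move_sig n_gt0 nzX (nsX i ltim) nzY.
have hY := has_value_epoint ltim nzs (fun a' b _ => YE a' b).
have hp g := has_value_psubst g hY.
have hid g := has_value_psubst_id X c g.
have := f_inv ltim; rewrite /rcomp -/p -/q => fE.
have he := has_value_div (hp p) (hp q) nqY.
have hi := has_value_div (hid p) (hid q) nqX.
by rewrite -fE in hi; apply: has_value_inj he hi.
Qed.

Variable S : K -> Prop.
Hypothesis SC : forall c : C, S (c%:MP)%:F.
Hypothesis Sz : forall g, @z_gens R m n g -> S g.
Hypothesis SB : forall a b, S a -> S b -> S (a - b).
Hypothesis SM : forall a b, S a -> S b -> S (a * b).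
Hypothesis SV : forall a, S a -> S a^-1.

Let S1 : S 1.
Proof. by have := SC 1; rewrite mpolyC1 rmorph1. Qed.

Let S_xpoint_bprod r s : (r < n)%N -> S (bprod (rows xpoint) r s).
Proof.
apply: (subfield_bprod_minors S1 SB SM SV) => i k; rewrite size_map size_iota.
  (* In 0-based terms, the ratio of the minors (i, k.+1) and (i.+1, k) is [z i.+1 (i + k).+1]. *)
  move=> ltim ltikn; have := Sz; move/(_ (z R m n i.+1 (i + k).+1)).
  rewrite /z !DeltaE //= -addSn -!addnS.
  have -> : (i.+1 + k.+1 - i.+1 = k.+1)%N by rewrite addKn.
  have -> : (i.+1 + k.+1 - i.+2 = k)%N by rewrite addnS -addSn addKn.
  apply; exists i.+1, (i + k).+1; split=> //.
    by rewrite ltnS leq_addr.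
  by rewrite /z !DeltaE //= -addSn -!addnS addKn addnS -addSn addKn.
by move=> leim leikn; apply: minor_xpoint_neq0.
Qed.

(** Natural numbers are distinct constants, and [g] has fewer than [size g] roots: one of the first
    [size g] naturals is not a root. *)
Let infinite_S (g : {poly K}) : g != 0 -> exists2 a, S a & g.[a] != 0.
Proof.
move=> nzg; pose t := [seq k%:R | k <- iota 0 (size g)] : seq K.
have natr_inj : injective (fun k : nat => k%:R : K).
  move=> k k' /eqP; rewrite -!(rmorph_nat (@tofrac {mpoly C[m * n]})) tofrac_eq.
  rewrite -!(rmorph_nat (@mpolyC (m * n) C)) mpolyC_eq eqr_nat => /eqP. exact.
have ut : uniq t by rewrite map_inj_uniq ?iota_uniq.
have /allPn[a /mapP[k _ ->] nra] : ~~ all (root g) t.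
  apply/negP => rt; have := max_poly_roots nzg rt ut.
  by rewrite size_map size_iota ltnn.
exists k%:R => //; have := SC k%:R; by rewrite !rmorph_nat.
Qed.

Lemma Inv_e_subfield : S f.
Proof.
have S0 := subfield0 S1 SB.
have gx : good xpoint != 0.
  apply/goodP; split=> [a b|i|]; first exact: xpoint_neq0.
    exact: sig_xpoint_neq0.
  by rewrite peval_xpoint tofrac_eq0 denom_ratioP.
have conn_refl X : conn X X by [].
have conn_trans X Y Z : conn X Y -> conn Y Z -> conn X Z.
  move=> [bXY eXY] [bYZ eYZ]; split=> [r s ltr|]; last by rewrite eYZ.
  by rewrite bYZ ?bXY.
have [Y [gY [bY eY] SY]] := exists_normal_form
  (fun X => regular_peval X q) conn_refl conn_trans conn_move infinite_S gx.
have SYall : forall a b, (a < m)%N -> (b < n)%N -> S (Y a b).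
  apply: (subfield_point SB SM SV _ SY); first by case/goodP: gY.
  by move=> r s ltr; rewrite bY //; apply: S_xpoint_bprod.
have Speval g : S (peval Y g).
  apply: subfield_sum => // t _; apply: SM; first exact: SC.
  apply: subfield_prod => // k _; apply: subfieldX => //.
  by case/mxvec_indexP: k => a b; rewrite mxvec_pointmx; apply: SYall.
rewrite [f]frac_repr -/p -/q -!peval_xpoint -eY.
by apply: SM => //; apply: SV.
Qed.

End Converse.

End Invariants.

End Interface.

Theorem theorem5p1 (R : realType) (m n : nat) :
  (0 < m)%N -> (0 < n)%N ->
  forall f : Kx R m n, Inv_e f <-> gen_subfield (@z_gens R m n) f.
Proof.
move=> _ n_gt0 f; split; last exact: gen_subfield_Inv_e.
by move=> f_inv S SC Sz SB SM SV; apply: Inv_e_subfield.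
Qed.
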